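(* If a graph $G$ satisfies $d(G)=c$, then for every $0<\delta\le\frac1{256}$ there is a subgraph $H$ of $G$ such that $d(H)\ge(1-\delta)c$ and $H$ is a $\delta$-expander.
   Context: All graphs are finite, without loops or parallel edges. Logarithms are base 2. $d(G)=|E(G)|/|V(G)|$. For a set $S$ of vertices of a graph, $N(S)$ is the set of vertices not in $S$ that are adjacent to at least one vertex of $S$. An $m$-vertex graph $H$ is a $\delta$-expander if for every integer $0\le d\le\log\log m-1$ and every $S\subseteq V(H)$ with $|S|\le m/2^{2^d}$ we have $$|N(S)|\ge\frac{\delta 2^d}{\log m\,(\log\log m)^2}\,|S|.$$ *)

(* Defs.v *)
From mathcomp Require Import all_boot all_order all_algebra.
From mathcomp Require Import reals exp.

Set Implicit Arguments.
Unset Strict Implicit.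
Unset Printing Implicit Defensive.

Import Order.TTheory GRing.Theory Num.Theory.
Local Open Scope ring_scope.

(* A simple graph with vertices drawn from T. The vertex set is a component
   rather than all of T, so that a graph and its subgraphs have the same type.
   It is nonempty, so that the density |E| / |V| is meaningful. *)
Record sgraph (T : finType) := SGraph {
  vertices : {set T};
  edges : {set {set T}};
  vertices_neq0 : vertices != set0;
  edgesP : forall e, e \in edges -> e \subset vertices /\ #|e| = 2%N
}.

Definition adjacent (T : finType) (G : sgraph T) (x y : T) : bool :=
  [set x; y] \in edges G.

Definition subgraph (T : finType) (H G : sgraph T) : bool :=
  (vertices H \subset vertices G) && (edges H \subset edges G).

Definition neighborhood (T : finType) (G : sgraph T) (S : {set T}) : {set T} :=
  [set v in vertices G | (v \notin S) && [exists u in S, adjacent G u v]].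

Definition density (R : realType) (T : finType) (G : sgraph T) : R :=
  #|edges G|%:R / #|vertices G|%:R.

Definition log2 (R : realType) (x : R) : R := ln x / ln 2.

(* No d satisfies the bound on d when m < 4. In particular this holds for
   m = 1, where log2 (log2 m) = 0 by the convention ln 0 = 0. *)
Definition expander (R : realType) (T : finType) (delta : R) (H : sgraph T) :
    Prop :=
  let m : R := #|vertices H|%:R in
  forall (d : nat) (S : {set T}),
    d%:R <= log2 (log2 m) - 1 ->
    S \subset vertices H ->
    #|S|%:R <= m / 2 ^+ (2 ^ d)%N ->
    delta * 2 ^+ d / (log2 m * log2 (log2 m) ^+ 2) * #|S|%:R
      <= #|neighborhood H S|%:R.

(* Main.v *)
(* Among the induced subgraphs on U, maximize (1 - delta * depth |U|) * density,
   where depth m = 1 - 1 / log log m, and then minimize |U|. If S violates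
   expansion in the maximizer H, minimality makes H - S strictly less dense
   than H, so S and its neighborhood span more than d(H) |S| edges. The density
   on S :|: N(S) thus drops by less than the factor 1 + |N(S)| / |S|, while the
   weight rises by at least as much, since the decrease of depth dominates
   2^d / (log m (log log m)^2): the maximum is exceeded. If N(S) is nonempty,
   delta <= 1/256 forces |S| > 512, so log log is harmless there. *)
Require Import Defs.
From mathcomp Require Import all_boot all_order all_algebra.
From mathcomp Require Import reals exp.
From mathcomp Require Import ring lra.

Set Implicit Arguments.
Unset Strict Implicit.
Unset Printing Implicit Defensive.

Import Order.TTheory GRing.Theory Num.Theory.
Local Open Scope ring_scope.

(** * Logarithms to base 2 *)

Lemma ln2_gt0 (R : realType) : 0 < ln 2 :> R.
Proof. by apply: ln_gt0; rewrite ltr1n. Qed.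

Lemma ln2_ge_half (R : realType) : 1 / 2 <= ln 2 :> R.
Proof.
have h : ln (2^-1) <= - (2^-1) :> R.
  by rewrite [X in ln X](_ : _ = 1 + - 2^-1); [apply: le_ln1Dx; lra | lra].
by move: h; rewrite lnV ?posrE//; lra.
Qed.

(* [2 = 3/2 * 4/3]; the constant is tight enough for [depth_gap]. *)
Lemma ln2_le (R : realType) : ln 2 <= 5 / 6 :> R.
Proof.
rewrite [X in ln X](_ : _ = (1 + 2^-1) * (1 + 3^-1)); last by field.
rewrite lnM ?posrE; [|lra|lra].
have h1 : ln (1 + 2^-1) <= 2^-1 :> R by apply: le_ln1Dx; lra.
have h2 : ln (1 + 3^-1) <= 3^-1 :> R by apply: le_ln1Dx; lra.
lra.
Qed.

Lemma ler_log2 (R : realType) (x y : R) : 0 < x -> x <= y -> log2 x <= log2 y.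
Proof.
move=> x0 xy; rewrite /log2 ler_pM2r ?invr_gt0 ?ln2_gt0// ler_ln// posrE.
exact: lt_le_trans xy.
Qed.

Lemma log2M (R : realType) (x y : R) :
  0 < x -> 0 < y -> log2 (x * y) = log2 x + log2 y.
Proof. by move=> x0 y0; rewrite /log2 lnM ?posrE// mulrDl. Qed.

Lemma log2_exp2 (R : realType) (n : nat) : log2 (2 ^+ n) = n%:R :> R.
Proof.
by rewrite /log2 lnXn// -[ln 2 *+ n]mulr_natl mulfK// gt_eqF// ln2_gt0.
Qed.

(** The exponent is a successor because [ln] vanishes at nonpositive reals: only a positive lower
    bound on [log2 x] forces [0 < x]. *)
Lemma exp2_le_of_log2 (R : realType) (n : nat) (x : R) :
  n.+1%:R <= log2 x -> 2 ^+ n.+1 <= x.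
Proof.
move=> h; have x0 : 0 < x.
  rewrite ltNge; apply/negP => x0.
  have : ln x <= 0 by apply: ln_le0; lra.
  have : 0 < log2 x by apply: lt_le_trans h; rewrite ltr0n.
  rewrite /log2 pmulr_lgt0 ?invr_gt0 ?ln2_gt0//; lra.
move: h; rewrite -log2_exp2 /log2 ler_pM2r ?invr_gt0 ?ln2_gt0//.
by rewrite ler_ln// posrE exprn_gt0.
Qed.

(* The maximum with [1] makes [depth] monotone on all reals despite the junk
   values of [ln] on nonpositive reals, and gives it values in [[0, 1]]. *)
Definition depth (R : realType) (m : R) : R :=
  1 - (Num.max 1 (log2 (log2 m)))^-1.

Lemma depth_ge0 (R : realType) (m : R) : 0 <= depth m.
Proof.
rewrite /depth subr_ge0 invf_le1 ?le_max ?lexx//.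
by rewrite lt_max ltr01.
Qed.

Lemma depth_le1 (R : realType) (m : R) : depth m <= 1.
Proof.
by rewrite /depth gerBl invr_ge0 le_max ler01.
Qed.

Lemma depth_le (R : realType) (a b : R) : a <= b -> depth a <= depth b.
Proof.
move=> ab; rewrite /depth lerB// lef_pV2 ?posrE ?lt_max ?ltr01//.
rewrite ge_max le_max lexx /= le_max.
have [h|h] := leP (log2 (log2 a)) 1; first by [].
have l2 : 2 <= log2 a by apply: (@exp2_le_of_log2 _ 0); apply: ltW.
have l4 : 2 ^+ 2 <= a by apply: (@exp2_le_of_log2 _ 1).
apply/orP; right; apply: ler_log2; first lra.
by apply: ler_log2 => //; lra.
Qed.

(* With [x = log2 m] and [X = log2 x], [- 1 / X] is concave in [x], with
   derivative [1 / (ln 2 * x * X ^ 2)]. The factor [1 / ln 2 > 1] makes up for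
   [n]: passing from [m] to [s + n] lowers [x] by slightly less than [2 ^ d]. *)
Lemma depth_gap (R : realType) (d : nat) (m s n : R) :
  d%:R <= log2 (log2 m) - 1 -> s <= m / 2 ^+ (2 ^ d)%N ->
  0 <= n -> n <= s / 12 -> 4 <= s + n ->
  2 ^+ d / (log2 m * log2 (log2 m) ^+ 2) <= depth m - depth (s + n).
Proof.
move=> hd hs n0 hn hsn.
set x := log2 m in hd *; set X := log2 x in hd *.
set y := log2 (s + n); set Y := log2 y.
have hX : d.+1%:R <= X by rewrite -natr1; lra.
have X1 : 1 <= X by apply: le_trans hX; rewrite ler1n.
have x2 : 2 <= x by apply: (@exp2_le_of_log2 _ 0).
have m4 : 2 ^+ 2 <= m by apply: (@exp2_le_of_log2 _ 1).
have y2 : 2 <= y by rewrite -[2](log2_exp2 R 2); apply: ler_log2; lra.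
have Y1 : 1 <= Y by rewrite -[1](log2_exp2 R 1); apply: ler_log2; lra.
have L0 := ln2_gt0 R; have L1 := ln2_ge_half R; have L2 := ln2_le R.
have P1 : 1 <= 2 ^+ d :> R by apply: exprn_ege1; rewrite ler1n.
set P : R := 2 ^+ d in P1 *.
(* Since [s + n <= 13/12 * s], [y] is at most [x - P + 1/6], and [5/6 * P <= P - 1/6] because
   [1 <= P]. *)
have hxy : ln 2 * P <= x - y.
  have le1 : y <= log2 (m * (1 + 12^-1) / 2 ^+ (2 ^ d)%N).
    by apply: ler_log2; lra.
  have p0 : 0 < 2 ^+ (2 ^ d)%N :> R by rewrite exprn_gt0.
  have e : log2 (m * (1 + 12^-1)) =
      log2 (m * (1 + 12^-1) / 2 ^+ (2 ^ d)%N) + P.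
    have -> : P = log2 (2 ^+ (2 ^ d)%N) by rewrite log2_exp2 natrX.
    by rewrite -log2M ?divr_gt0 ?divfK ?gt_eqF//; lra.
  have e2 : log2 (m * (1 + 12^-1)) <= x + 6^-1.
    rewrite log2M; [|lra|lra]; rewrite lerD2l /log2 ler_pdivrMr//.
    have : ln (1 + 12^-1) <= 12^-1 :> R by apply: le_ln1Dx; lra.
    lra.
  have : ln 2 * P <= 5 / 6 * P by rewrite ler_pM2r//; lra.
  lra.
(* From [ln t <= t - 1] at [t = y / x]; the factor [ln 2] in [hxy] cancels the [1 / ln 2] of the
   outer [log2]. *)
have hXY : P / x <= X - Y.
  have : ln (y / x) <= y / x - 1.
    rewrite [X in ln X](_ : _ = 1 + (y / x - 1)); last lra.
    apply: le_ln1Dx.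
    have : 0 < y / x by rewrite divr_gt0//; lra.
    lra.
  rewrite ln_div ?posrE; [|lra|lra] => h.
  rewrite /X /Y /log2 -mulrBl ler_pdivlMr//.
  suff : P / x * ln 2 <= 1 - y / x by lra.
  rewrite [X in _ <= X](_ : _ = (x - y) / x); last by field; lra.
  by rewrite mulrAC ler_pM2r ?invr_gt0; [rewrite mulrC | lra].
rewrite /depth -/x -/y -/X -/Y !max_r//.
rewrite [X in _ <= X](_ : _ = (X - Y) / (X * Y)); last by field; lra.
rewrite invfM mulrA.
have Q0 : 0 <= P / x by rewrite divr_ge0//; lra.
apply: ler_pM => //; first by rewrite invr_ge0 sqr_ge0.
have X0 : 0 < X by lra.
have Y0 : 0 < Y by lra.
have YX : Y <= X by rewrite -subr_ge0 (le_trans Q0).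
rewrite lef_pV2; first by rewrite expr2 ler_pM2l.
  by rewrite posrE exprn_gt0.
by rewrite posrE; apply: mulr_gt0.
Qed.

(** * Induced subgraphs and their edges *)

Definition induced_edges (T : finType) (G : sgraph T) (U : {set T}) :=
  [set e in edges G | e \subset U].

Lemma induced_edgesP (T : finType) (G : sgraph T) (U : {set T}) e :
  e \in induced_edges G U -> e \subset U /\ #|e| = 2%N.
Proof. by rewrite inE => /andP[/edgesP[_ ->] ->]. Qed.

Definition induced (T : finType) (G : sgraph T) (U : {set T}) (U0 : U != set0) :
    sgraph T :=
  SGraph U0 (@induced_edgesP T G U).

Lemma induced_subgraph (T : finType) (G : sgraph T) (U : {set T})
    (U0 : U != set0) : U \subset vertices G -> subgraph (induced G U0) G.
Proof.
by move=> UG; rewrite /subgraph UG /=; apply/subsetP => e; rewrite inE => /andP[].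
Qed.

(** An edge inside [U] either avoids [S] or has an end [x] in [S]; in the latter case its other end
    lies in [S] or is a neighbor of [x]. *)
Lemma card_induced_edges (T : finType) (G : sgraph T) (U : {set T})
    (U0 : U != set0) (S : {set T}) :
  S \subset U ->
  (#|induced_edges G U| <= #|induced_edges G (U :\: S)|
     + #|induced_edges G (S :|: neighborhood (induced G U0) S)|)%N.
Proof.
move=> SU; apply: leq_trans (leq_card_setU _ _); apply: subset_leq_card.
apply/subsetP => e; rewrite !inE => /andP[eG eU]; rewrite eG /=.
rewrite subsetD eU /=; case: (boolP [disjoint e & S]) => //= /pred0Pn[x].
move=> /andP[/= xe xS]; apply/subsetP => z ze; rewrite !inE.
case: (boolP (z \in S)) => //= zS; rewrite (subsetP eU _ ze) /=.
have zx : x != z by apply: contraNneq zS => <-.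
apply/existsP; exists x; rewrite xS /adjacent /= inE.
suff -> : [set x; z] = e by rewrite eG.
apply/eqP; rewrite eqEcard (edgesP eG).2 cards2 zx leqnn andbT.
by apply/subsetP => u; rewrite !inE => /orP[]/eqP->.
Qed.

(** Ties in [f] are broken by the least [g], so a competitor with smaller [g] must lose strictly.
    This is the source of the strict inequality for [U :\: S]. *)
Lemma smallest_maximizer (R : realDomainType) (I : finType) (P : pred I)
    (f : I -> R) (g : I -> nat) (i0 : I) : P i0 ->
  exists2 i, P i & forall j, P j ->
    f j <= f i /\ ((g j < g i)%N -> f j < f i).
Proof.
move=> Pi0; case: (Order.TotalTheory.arg_maxP f Pi0) => i1 Pi1 max1.
have Q1 : P i1 && (f i1 <= f i1) by rewrite Pi1 lexx.
case: (arg_minnP (P := fun i => P i && (f i1 <= f i)) g Q1) => i /andP[Pi f1i] min1.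
exists i => // j Pj; have fj : f j <= f i := le_trans (max1 j Pj) f1i.
split=> // gji; rewrite lt_neqAle fj andbT; apply/eqP => e.
by have := min1 j; rewrite Pj e f1i => /(_ isT); rewrite leqNgt gji.
Qed.

(** * Expansion of the smallest maximizer *)

Theorem lemma1p2 (R : realType) (T : finType) (G : sgraph T) (c : R)
    (hc : density R G = c) (delta : R) (hdelta0 : 0 < delta)
    (hdelta : delta <= 1 / 256) :
  exists H : sgraph T,
    [/\ subgraph H G, (1 - delta) * c <= density R H & expander delta H].
Proof.
pose w (k : nat) : R := 1 - delta * depth k%:R.
have w_le1 k : w k <= 1.
  by rewrite /w gerBl mulr_ge0 ?depth_ge0// ltW.
have w_ge k : 1 - delta <= w k.
  by rewrite /w lerB// ger_pMr// depth_le1.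
have w_gt0 k : 0 < w k by apply: lt_le_trans (w_ge k); lra.
have w_anti a b : (a <= b)%N -> w b <= w a.
  by move=> ab; rewrite /w lerB// ler_pM2l// depth_le// ler_nat.
pose D (U : {set T}) : R := #|induced_edges G U|%:R / #|U|%:R.
have D_ge0 U : 0 <= D U by rewrite divr_ge0.
pose P (U : {set T}) := (U \subset vertices G) && (U != set0).
have PG : P (vertices G) by rewrite /P subxx vertices_neq0.
have [U /andP[UG U0] maxU] :=
  smallest_maximizer (fun U : {set T} => w #|U| * D U) (fun U => #|U|) PG.
exists (induced G U0); split; first exact: induced_subgraph.
  have DG : D (vertices G) = c.
    rewrite -hc /density /D; congr (_%:R / _); apply: eq_card => e.
    by rewrite inE; case: (boolP (e \in edges G)) => // /edgesP[->].
  rewrite [density _ _](_ : _ = D U) // -DG.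
  (* All weights lie between [1 - delta] and [1], so passing from [G] to the maximizer costs at most
     a factor [1 - delta] in density. *)
  have [h _] := maxU _ PG.
  apply: le_trans (_ : w #|vertices G| * D (vertices G) <= _).
    by rewrite ler_wpM2r.
  by apply: le_trans h _; rewrite ler_piMl.
move=> d S /= hd SU hS.
set m := #|U|%:R in hd hS *.
set N := neighborhood _ S.
set gamma := delta * _ / _.
rewrite leNgt; apply/negP => hN.
have [S0|S0] := eqVneq S set0.
  by move: hN; rewrite S0 cards0 mulr0 ltNge ler0n.
have s1 : 1 <= #|S|%:R :> R by rewrite ler1n card_gt0.
have hX : d.+1%:R <= log2 (log2 m) by rewrite -natr1; lra.
have X1 : 1 <= log2 (log2 m) by apply: le_trans hX; rewrite ler1n.
have x2 : 2 ^+ d.+1 <= log2 m := exp2_le_of_log2 hX.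
have P1 : 1 <= 2 ^+ d :> R by apply: exprn_ege1; rewrite ler1n.
have x0 : 0 < log2 m by rewrite exprS in x2; lra.
have gamma_le : gamma <= delta / 2.
  rewrite /gamma ler_pdivrMr; last by rewrite mulr_gt0// exprn_gt0//; lra.
  rewrite -mulrA ler_pM2l// mulrA.
  apply: le_trans (_ : 2^-1 * log2 m * 1 <= _); first by rewrite exprS in x2; lra.
  by rewrite ler_pM2l ?exprn_ege1// mulr_gt0// invr_gt0.
have hSm : (#|S| < #|U|)%N.
  rewrite -(ltr_nat R) -/m; apply: le_lt_trans hS _.
  have m0 : 0 < m by rewrite ltr0n card_gt0.
  rewrite gtr_pMr// invf_lt1 ?exprn_gt0//.
  by rewrite exprn_egt1 ?ltr1n// -lt0n expn_gt0.
have NS : #|S :|: N| = (#|S| + #|N|)%N.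
  rewrite cardsU [S :&: N](_ : _ = set0) ?cards0 ?subn0//.
  by apply/setP => z; rewrite !inE; case: (z \in S) => //=; rewrite andbF.
have PA : P (S :|: N).
  rewrite /P subUset (subset_trans SU UG) /=; apply/andP; split.
    by apply: subset_trans UG; apply/subsetP => z; rewrite inE => /andP[].
  by rewrite setU_eq0 negb_and S0.
have cB : #|U :\: S| = (#|U| - #|S|)%N by rewrite cardsD (setIidPr SU).
have PB : P (U :\: S).
  rewrite /P (subset_trans (subsetDl _ _) UG) /= -card_gt0 cB.
  by rewrite subn_gt0.
have m0 : 0 < m by rewrite ltr0n card_gt0.
have hB : #|induced_edges G (U :\: S)|%:R < D U * (m - #|S|%:R).
  have [_] := maxU _ PB.
  have lt : (#|U :\: S| < #|U|)%N by rewrite cB ltn_subrL !card_gt0 S0.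
  move=> /(_ lt) h.
  (* The smaller set has at least the weight of [U], so its loss must come from the density. *)
  have : w #|U| * D (U :\: S) < w #|U| * D U.
    by apply: le_lt_trans h; rewrite ler_wpM2r// w_anti// ltnW.
  rewrite ltr_pM2l// /D ltr_pdivrMr; last by rewrite ltr0n cB subn_gt0.
  by rewrite cB natrB// ltnW.
have hA : D U * #|S|%:R < #|induced_edges G (S :|: N)|%:R.
  have := card_induced_edges G U0 SU; rewrite -/N -(ler_nat R) natrD.
  have -> : #|induced_edges G U|%:R = D U * m by rewrite /D divfK// gt_eqF.
  lra.
have [hmax _] := maxU _ PA.
set s : R := #|S|%:R in s1 hA hN hS *.
set n : R := #|N|%:R in hN *.
have n0 : 0 <= n by rewrite ler0n.
have hmax2 : w #|S :|: N| * #|induced_edges G (S :|: N)|%:R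
             <= w #|U| * D U * (s + n).
  move: hmax; rewrite {2}/D mulrA ler_pdivrMr; last by rewrite NS natrD; lra.
  by rewrite {2}NS natrD.
have hlt : w #|S :|: N| * (D U * s) < w #|U| * D U * (s + n).
  by apply: lt_le_trans hmax2; rewrite ltr_pM2l.
(* If [D U] were zero, [hlt] would read [0 < 0]. *)
have DU : 0 < D U.
  rewrite lt_neqAle D_ge0 andbT; apply/eqP => e.
  by move: hlt; rewrite -e !(mulr0, mul0r) ltxx.
have {}hlt : w #|S :|: N| * s < w #|U| * (s + n).
  by rewrite -(ltr_pM2l DU); lra.
move: hlt; rewrite ltNge => /negP; apply.
(* Without neighbors [s] may be too small for [depth_gap], but monotonicity of [w] already
   suffices. *)
have [N0|N0] := posnP #|N|.
  by rewrite /n N0 addr0 ler_wpM2r ?w_anti ?NS ?N0 ?addn0// ltnW.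
have n1 : 1 <= n by rewrite ler1n.
(* Now [1 <= n < gamma * s <= s / 512], which yields both size conditions of [depth_gap]. *)
have gs : gamma * s <= 1 / 512 * s by rewrite ler_wpM2r; lra.
have gap := @depth_gap _ d m s n hd hS n0.
have {}gap : 2 ^+ d / (log2 m * log2 (log2 m) ^+ 2) <= depth m - depth (s + n).
  by apply: gap; lra.
have : gamma <= w #|S :|: N| - w #|U|.
  rewrite /w NS natrD -/s -/n -/m /gamma -mulrA.
  move: gap; rewrite -(ler_pM2l hdelta0); lra.
move=> /(fun h => ler_wpM2r (_ : 0 <= s) h) hw.
have {}hw : gamma * s <= (w #|S :|: N| - w #|U|) * s by apply: hw; lra.
(* The gain in weight on [s] is at least [gamma * s > n], while the [n] new vertices cost at most
   [n]. *)
have : w #|U| * n <= n by rewrite ler_piMl.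
lra.
Qed.
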